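(* Let $T>0$, $0<\eta<T$, $0<\alpha<\frac{1}{\eta}$, let $f\in C([0,\infty),[0,\infty))$, and let $a\in C([0,T],[0,\infty))$ with $a(t_0)>0$ for some $t_0\in[0,T]$. Consider the boundary value problem \[ u''(t)+a(t)f(u(t))=0,\quad 0<t<T,\qquad u'(0)=0,\quad u(T)=\alpha\int_0^{\eta}u(s)\,ds. \tag{P} \] Assume that $f_0=f_\infty=0$, and that there exist constants $\rho_2>0$ and $M_2\in[\Lambda_2,\infty)$ such that $f(u)\ge M_2\rho_2$ for all $u\in[\gamma\rho_2,\rho_2]$. Then (P) has at least two positive solutions $u_1,u_2$ with \[ 0<\|u_1\|<\rho_2<\|u_2\|. \]
   Context: $f_0=\lim_{u\to0^+}\frac{f(u)}{u}$, $f_\infty=\lim_{u\to\infty}\frac{f(u)}{u}$. $\|u\|=\max_{t\in[0,T]}|u(t)|$. $\gamma=\dfrac{\alpha\eta(T-\eta)}{T-\alpha\eta^2}$ and $\Lambda_2=\dfrac{1-\alpha\eta}{\gamma\left(\int_\eta^T (T-s)a(s)\,ds+\frac12\int_0^\eta\left[2(T-\eta)+\alpha(\eta^2-s^2)\right]a(s)\,ds\right)}$. A positive solution of (P) is a function $u\in C^2([0,T])$ satisfying (P) with $u(t)\ge0$ on $[0,T]$ and $u$ not identically zero. *)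

(* Defs.v *)
From Stdlib Require Import Reals Lra.
From Coquelicot Require Import Coquelicot.
Open Scope R_scope.

Definition cont_on (D : R -> Prop) (g : R -> R) : Prop :=
  forall t, D t -> filterlim g (within D (locally t)) (locally (g t)).

Definition deriv_on (a b : R) (g g' : R -> R) : Prop :=
  forall t, a <= t <= b ->
    filterlim (fun h => (g (t + h) - g t) / h)
      (within (fun h => h <> 0 /\ a <= t + h <= b) (locally 0))
      (locally (g' t)).

Definition C2_on (a b : R) (u u1 u2 : R -> R) : Prop :=
  deriv_on a b u u1 /\ deriv_on a b u1 u2 /\ cont_on (fun s => a <= s <= b) u2.

Definition supnorm (T : R) (u : R -> R) : R :=
  real (Lub_Rbar (fun y => exists t, 0 <= t <= T /\ y = Rabs (u t))).

Definition gamma_c (T eta alpha : R) : R :=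
  alpha * eta * (T - eta) / (T - alpha * eta ^ 2).

Definition Lambda2 (T eta alpha : R) (a : R -> R) : R :=
  (1 - alpha * eta) /
  (gamma_c T eta alpha *
   (RInt (fun s => (T - s) * a s) eta T
    + / 2 * RInt (fun s => (2 * (T - eta) + alpha * (eta ^ 2 - s ^ 2)) * a s) 0 eta)).

Definition positive_solution (T eta alpha : R) (a f : R -> R) (u : R -> R) : Prop :=
  (exists u1 u2 : R -> R,
      C2_on 0 T u u1 u2 /\
      (forall t, 0 < t < T -> u2 t + a t * f (u t) = 0) /\
      u1 0 = 0 /\
      u T = alpha * RInt u 0 eta) /\
  (forall t, 0 <= t <= T -> 0 <= u t) /\
  (exists t, 0 <= t <= T /\ u t <> 0).

(* Main.v *)
(** Shooting replaces the fixed point theory of cones. A solution of the integral equation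
    [u(t) = c - int_0^t int_0^r a(s) f(u(s)) ds dr] solves (P) as soon as its defect
    [u(T) - alpha * int_0^eta u] vanishes. As [f] is only continuous, the solution with [u(0) = c]
    need not be unique, so [f(u(s))] is first replaced by [f(u(s - h))] with a delay [h > 0]: then
    the solution is unique and depends continuously on [c].

    If [f(x) <= e * c] on [[0, c]] with a small constant [e], which happens for some small and for
    some large [c] because [f_0 = f_infty = 0], the defect is nonnegative. At [c = rho2] it is
    negative: were it nonnegative, concavity would give [u >= gamma * rho2], hence
    [f(u) >= M2 * rho2], and [M2 >= Lambda2] together with [gamma < 1] makes the defect negative.
    The intermediate value theorem gives zeros of the defect on both sides of [rho2], and
    compactness as [h -> 0] gives two solutions of (P); neither has norm [u(0) = rho2], since the
    defect is negative there for [h = 0] as well. *)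

Require Import Defs.
From Stdlib Require Import Reals Lra Lia Classical IndefiniteDescription.
From Coquelicot Require Import Coquelicot.
From mathcomp Require filter.
Open Scope R_scope.

(* [a] and [f] are given on [[0, T]] and [[0, oo)] only; composing them with [clamp] extends them to
   continuous functions on the line. *)
Definition clamp (T t : R) : R := Rmax 0 (Rmin t T).

Lemma clamp_bounds (T t : R) : 0 <= T -> 0 <= clamp T t <= T.
Proof. intros; unfold clamp, Rmax, Rmin; repeat destruct Rle_dec; lra. Qed.

Lemma clamp_id (T t : R) : 0 <= t <= T -> clamp T t = t.
Proof. intros; unfold clamp, Rmax, Rmin; repeat destruct Rle_dec; lra. Qed.

Lemma clamp_neg (T t : R) : 0 <= T -> t <= 0 -> clamp T t = 0.
Proof. intros; unfold clamp, Rmax, Rmin; repeat destruct Rle_dec; lra. Qed.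

Lemma clamp_le (T t : R) : 0 <= t -> clamp T t <= t.
Proof. intros; unfold clamp, Rmax, Rmin; repeat destruct Rle_dec; lra. Qed.

Lemma clamp_lip (T s t : R) : 0 <= T -> Rabs (clamp T s - clamp T t) <= Rabs (s - t).
Proof.
  intros; unfold clamp, Rmax, Rmin, Rabs; repeat destruct Rle_dec; repeat destruct Rcase_abs; lra.
Qed.

(** * Continuity and Riemann integrals on the line *)

Lemma continuous_eps (f : R -> R) (x : R) :
  (forall eps, 0 < eps -> exists d, 0 < d /\ forall y, Rabs (y - x) < d -> Rabs (f y - f x) < eps) ->
  continuous f x.
Proof.
  intros H. apply filterlim_locally. intros eps.
  destruct (H eps (cond_pos eps)) as [d [Hd Hf]].
  exists (mkposreal d Hd). intros y Hy. apply Hf, Hy.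
Qed.

Lemma lipschitz_continuous (L : R) (f : R -> R) :
  (forall x y, Rabs (f x - f y) <= L * Rabs (x - y)) -> forall x, continuous f x.
Proof.
  intros H x. apply continuous_eps. intros eps He.
  assert (HL : 0 < Rabs L + 1) by (pose proof (Rabs_pos L); lra).
  exists (eps / (Rabs L + 1)). split. { apply Rdiv_lt_0_compat; lra. }
  intros y Hy. apply Rle_lt_trans with (1 := H y x).
  apply Rle_lt_trans with ((Rabs L + 1) * Rabs (y - x)).
  { apply Rmult_le_compat_r; [apply Rabs_pos|]. pose proof (Rle_abs L); lra. }
  apply (Rmult_lt_compat_l (Rabs L + 1)) in Hy; [|lra].
  replace eps with ((Rabs L + 1) * (eps / (Rabs L + 1))) by (field; lra). exact Hy.
Qed.

Lemma clamp_continuous (T t : R) : 0 <= T -> continuous (clamp T) t.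
Proof.
  intros HT. apply lipschitz_continuous with 1. intros x y. rewrite Rmult_1_l. now apply clamp_lip.
Qed.

Lemma ex_RInt_cont (f : R -> R) (a b : R) : (forall x, continuous f x) -> ex_RInt f a b.
Proof. intros H. apply (@ex_RInt_continuous R_CompleteNormedModule). intros; apply H. Qed.

Lemma is_derive_RInt_cont (f : R -> R) (a t : R) :
  (forall x, continuous f x) -> is_derive (fun t => RInt f a t) t (f t).
Proof.
  intros H. apply (@is_derive_RInt R_NormedModule) with (a := a); [|apply H].
  apply filter_forall. intros x. apply (@RInt_correct R_CompleteNormedModule), ex_RInt_cont, H.
Qed.

Lemma is_derive_continuous (f f' : R -> R) :
  (forall x, is_derive f x (f' x)) -> forall x, continuous f x.
Proof. intros H x. apply (@ex_derive_continuous R_AbsRing R_NormedModule). now exists (f' x). Qed.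

Lemma RInt_cont_continuous (f : R -> R) (a : R) :
  (forall x, continuous f x) -> forall t, continuous (fun t => RInt f a t) t.
Proof. intros H. apply is_derive_continuous with f. intros; now apply is_derive_RInt_cont. Qed.

Lemma RInt_antiderivative (F f : R -> R) (a b : R) :
  (forall x, is_derive F x (f x)) -> (forall x, continuous f x) -> RInt f a b = F b - F a.
Proof.
  intros HF Hf. apply (@is_RInt_unique R_CompleteNormedModule).
  apply (@is_RInt_derive R_CompleteNormedModule F f); intros; auto.
Qed.

Lemma RInt_minus_cont (f g : R -> R) (a b : R) :
  (forall x, continuous f x) -> (forall x, continuous g x) ->
  RInt (fun x => f x - g x) a b = RInt f a b - RInt g a b.
Proof.
  intros Hf Hg. apply (@RInt_minus R_CompleteNormedModule); now apply ex_RInt_cont.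
Qed.

Lemma RInt_scal_cont (f : R -> R) (k a b : R) :
  (forall x, continuous f x) -> RInt (fun x => k * f x) a b = k * RInt f a b.
Proof. intros Hf. apply (@RInt_scal R_CompleteNormedModule). now apply ex_RInt_cont. Qed.

Lemma RInt_const_R (a b c : R) : RInt (fun _ => c) a b = (b - a) * c.
Proof. apply (@RInt_const R_CompleteNormedModule). Qed.

Lemma RInt_split (f : R -> R) (a b c : R) :
  (forall x, continuous f x) -> RInt f a c = RInt f a b + RInt f b c.
Proof.
  intros H. symmetry. apply (@RInt_Chasles R_CompleteNormedModule); now apply ex_RInt_cont.
Qed.

Lemma RInt_bounds (f : R -> R) (a b m M : R) :
  a <= b -> (forall x, continuous f x) -> (forall x, a <= x <= b -> m <= f x <= M) ->
  (b - a) * m <= RInt f a b <= (b - a) * M.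
Proof.
  intros Hab Hc Hf. rewrite <- !RInt_const_R.
  split; apply RInt_le; auto using ex_RInt_cont; try (apply ex_RInt_cont; intros; apply continuous_const);
    intros x Hx; apply Hf; lra.
Qed.

(** * Double integrals *)

(** The solution of [v'' = y] with [v(0) = v'(0) = 0]. *)
Definition iint (y : R -> R) (t : R) : R := RInt (fun s => RInt y 0 s) 0 t.

Lemma iint_0 (y : R -> R) : iint y 0 = 0.
Proof. apply (@RInt_point R_CompleteNormedModule). Qed.

Lemma is_derive_iint (y : R -> R) (t : R) :
  (forall x, continuous y x) -> is_derive (iint y) t (RInt y 0 t).
Proof.
  intros H. apply (is_derive_RInt_cont (fun s => RInt y 0 s)). now apply RInt_cont_continuous.
Qed.

Lemma iint_continuous (y : R -> R) :
  (forall x, continuous y x) -> forall t, continuous (iint y) t.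
Proof. intros H. apply is_derive_continuous with (fun t => RInt y 0 t). intros; now apply is_derive_iint. Qed.

Lemma iint_ext (y z : R -> R) (t : R) :
  0 <= t -> (forall s, 0 < s < t -> y s = z s) -> iint y t = iint z t.
Proof.
  intros Ht H. apply (@RInt_ext R_CompleteNormedModule). intros s Hs.
  rewrite Rmin_left, Rmax_right in Hs by lra.
  apply (@RInt_ext R_CompleteNormedModule). intros r Hr.
  rewrite Rmin_left, Rmax_right in Hr by lra. apply H; lra.
Qed.

Lemma iint_minus (y z : R -> R) (t : R) :
  (forall x, continuous y x) -> (forall x, continuous z x) ->
  iint (fun s => y s - z s) t = iint y t - iint z t.
Proof.
  intros Hy Hz. unfold iint. rewrite <- RInt_minus_cont by now apply RInt_cont_continuous.
  apply (@RInt_ext R_CompleteNormedModule). intros s _. now apply RInt_minus_cont.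
Qed.

Lemma iint_scal (y : R -> R) (k t : R) :
  (forall x, continuous y x) -> iint (fun s => k * y s) t = k * iint y t.
Proof.
  intros Hy. unfold iint. rewrite <- RInt_scal_cont by now apply RInt_cont_continuous.
  apply (@RInt_ext R_CompleteNormedModule). intros s _. now apply RInt_scal_cont.
Qed.

(** Mean value theorem: the derivative [RInt y 0 r] is at most [T * B] in absolute value on
    [[0, T]]. *)
Lemma iint_lipschitz (y : R -> R) (T B s t : R) :
  (forall x, continuous y x) -> (forall x, 0 <= x <= T -> Rabs (y x) <= B) ->
  0 <= s <= T -> 0 <= t <= T -> Rabs (iint y s - iint y t) <= T * B * Rabs (s - t).
Proof.
  intros Hc HB Hs Ht.
  assert (Hv : forall r, 0 <= r <= T -> Rabs (RInt y 0 r) <= T * B).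
  { intros r Hr. apply Rle_trans with ((r - 0) * B).
    - apply abs_RInt_le_const; [lra|now apply ex_RInt_cont|]. intros x Hx; apply HB; lra.
    - assert (0 <= B) by (apply Rle_trans with (2 := HB 0 ltac:(lra)), Rabs_pos). nra. }
  destruct (MVT_gen (iint y) t s (fun r => RInt y 0 r)) as [c [Hcb Heq]].
  - intros; now apply is_derive_iint.
  - intros. apply continuity_pt_filterlim. now apply iint_continuous.
  - rewrite Heq, Rabs_mult. apply Rmult_le_compat_r; [apply Rabs_pos|]. apply Hv.
    unfold Rmin, Rmax in Hcb; repeat destruct Rle_dec; lra.
Qed.

Lemma iint_abs_le (y : R -> R) (T B t : R) :
  (forall x, continuous y x) -> (forall x, 0 <= x <= T -> Rabs (y x) <= B) ->
  0 <= t <= T -> Rabs (iint y t) <= T * T * B.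
Proof.
  intros Hc HB Ht.
  pose proof (iint_lipschitz y T B t 0 Hc HB Ht ltac:(lra)) as H.
  rewrite iint_0, !Rminus_0_r, (Rabs_right t) in H by lra.
  apply Rle_trans with (1 := H).
  assert (0 <= B) by (apply Rle_trans with (2 := HB 0 ltac:(lra)), Rabs_pos).
  replace (T * T * B) with (T * B * T) by ring.
  apply Rmult_le_compat_l; [|lra]. apply Rmult_le_pos; lra.
Qed.

Section nonnegative_weight.
Context (y : R -> R) (T : R).
Context (y_cont : forall x, continuous y x) (y_ge0 : forall x, 0 <= x <= T -> 0 <= y x).

Lemma RInt_nondecreasing (s t : R) : 0 <= s -> s <= t -> t <= T -> RInt y 0 s <= RInt y 0 t.
Proof.
  intros Hs Hst Ht. rewrite (RInt_split y 0 s t) by auto.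
  enough (0 <= RInt y s t) by lra.
  apply RInt_ge_0; auto using ex_RInt_cont. intros; apply y_ge0; lra.
Qed.

(** The increment is the integral of [RInt y 0 r] over [[s, t]], and this integrand is nondecreasing
    because [y >= 0]. The two bounds express the convexity of [iint y]. *)
Lemma iint_increment (s t : R) : 0 <= s -> s <= t -> t <= T ->
  (t - s) * RInt y 0 s <= iint y t - iint y s <= (t - s) * RInt y 0 t.
Proof.
  intros Hs Hst Ht. unfold iint.
  rewrite (RInt_split (fun r => RInt y 0 r) 0 s t) by now apply RInt_cont_continuous.
  rewrite Rplus_minus_l.
  apply RInt_bounds; auto. { now apply RInt_cont_continuous. }
  intros x Hx; split; apply RInt_nondecreasing; lra.
Qed.

Lemma iint_nondecreasing (s t : R) : 0 <= s -> s <= t -> t <= T -> iint y s <= iint y t.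
Proof.
  intros Hs Hst Ht. pose proof (iint_increment s t Hs Hst Ht) as [H _].
  pose proof (RInt_nondecreasing 0 s ltac:(lra) Hs ltac:(lra)) as H'.
  rewrite (@RInt_point R_CompleteNormedModule) in H'. change (zero : R) with 0 in H'. nra.
Qed.

Lemma iint_nonneg (t : R) : 0 <= t <= T -> 0 <= iint y t.
Proof. intros Ht. rewrite <- (iint_0 y). apply iint_nondecreasing; lra. Qed.

(** Convexity: [RInt y 0 t] lies between the slope of [iint y] on [[0, t]] and its slope on
    [[t, T]]. *)
Lemma iint_chord (t : R) : 0 <= t <= T -> T * iint y t <= t * iint y T.
Proof.
  intros Ht.
  pose proof (iint_increment 0 t ltac:(lra) ltac:(lra) ltac:(lra)) as [_ H1].
  pose proof (iint_increment t T ltac:(lra) ltac:(lra) ltac:(lra)) as [H2 _].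
  rewrite iint_0 in H1. nra.
Qed.

Lemma RInt_iint_le (t : R) : 0 <= t <= T -> 0 <= RInt (iint y) 0 t <= t * iint y t.
Proof.
  intros Ht. pose proof (RInt_bounds (iint y) 0 t 0 (iint y t)) as H.
  rewrite Rminus_0_r, Rmult_0_r in H. apply H; [lra|now apply iint_continuous|].
  intros x Hx; split; [apply iint_nonneg; lra|apply iint_nondecreasing; lra].
Qed.

End nonnegative_weight.

(** * Compactness *)

(** Stands in for the diagonal extraction of subsequences: along one ultrafilter every bounded real
    sequence converges, so pointwise limits exist at all points at once. *)
Lemma eventually_ultrafilter :
  exists G : (nat -> Prop) -> Prop, ProperFilter G /\
    (forall P, Hierarchy.eventually P -> G P) /\ (forall P, G P \/ G (fun n => ~ P n)).
Proof.
  destruct (@filter.ultraFilterLemma nat Hierarchy.eventually) as [G [HG HE]].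
  { split.
    - intros [N HN]. exact (HN N (le_n N)).
    - split.
      + exists 0%nat; intros; exact I.
      + intros P Q HP HQ. exact (filter_and P Q HP HQ).
      + intros P Q HPQ HP. exact (filter_imp P Q HPQ HP). }
  exists G. pose proof (@filter.ultra_proper _ _ HG) as [Hne [HT HI HS]].
  split; [split; [|split]|split].
  (* A member of [G] without elements would be contained in the empty set. *)
  - intros P HP. apply NNPP. intros Hn. apply Hne. apply (HS P); [|exact HP].
    intros x Hx. apply Hn. now exists x.
  - apply (HS (fun _ => True)); [now intros|exact HT].
  - intros P Q HP HQ. exact (HI P Q HP HQ).
  - intros P Q HPQ HP. exact (HS P Q HPQ HP).
  - exact HE.
  - intros P. exact (filter.in_ultra_setVsetC P HG).
Qed.

(** The limit is the supremum of the [y] that lie below [x n] for [G]-almost all [n]. *)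
Lemma ultrafilter_limit (G : (nat -> Prop) -> Prop) (x : nat -> R) (M : R) :
  ProperFilter G -> (forall P, G P \/ G (fun n => ~ P n)) -> (forall n, Rabs (x n) <= M) ->
  exists l, forall eps, 0 < eps -> G (fun n => Rabs (x n - l) < eps).
Proof.
  intros HG Hu HM.
  destruct (completeness (fun y => G (fun n => y <= x n))) as [l [Hub Hlub]].
  - exists M. intros y Hy. destruct (filter_ex _ Hy) as [n Hn].
    specialize (HM n). apply Rabs_le_between in HM. lra.
  - exists (- M). apply (@filter_forall _ G _). intros n. specialize (HM n).
    apply Rabs_le_between in HM. lra.
  - exists l. intros eps He.
    assert (H1 : G (fun n => l - eps < x n)).
    { apply NNPP. intros Hn. enough (l <= l - eps) by lra.
      apply Hlub. intros y Hy. apply Rnot_lt_le. intros Hlt. apply Hn.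
      revert Hy. apply filter_imp. intros; lra. }
    (* Maximality of [G]: otherwise [l + eps / 2] would belong to the set whose supremum is [l]. *)
    assert (H2 : G (fun n => ~ (l + eps / 2 <= x n))).
    { destruct (Hu (fun n => l + eps / 2 <= x n)) as [H|H]; [|exact H].
      specialize (Hub _ H). lra. }
    generalize (filter_and (F := G) _ _ H1 H2). apply filter_imp. intros n [? ?].
    apply Rabs_def1; lra.
Qed.

(* A weak form of the Arzela-Ascoli theorem: [w] is a uniform cluster point of the sequence. *)
Lemma equilipschitz_cluster (T L M : R) (w_ : nat -> R -> R) :
  0 < T -> 0 < L ->
  (forall n s t, Rabs (w_ n s - w_ n t) <= L * Rabs (s - t)) ->
  (forall n t, Rabs (w_ n t) <= M) ->
  (forall n t, w_ n t = w_ n (clamp T t)) ->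
  exists w, (forall s t, Rabs (w s - w t) <= L * Rabs (s - t)) /\
    forall eps N, 0 < eps -> exists n, (N <= n)%nat /\ forall t, Rabs (w_ n t - w t) <= eps.
Proof.
  intros HT HL Hlip HM Hcl.
  destruct eventually_ultrafilter as [G [HG [HE Hu]]].
  destruct (IndefiniteDescription.functional_choice
    (fun t l => forall eps, 0 < eps -> G (fun n => Rabs (w_ n t - l) < eps)))
    as [w Hw].
  { intros t. apply (ultrafilter_limit G (fun n => w_ n t) M); auto. }
  exists w.
  assert (Hwl : forall s t, Rabs (w s - w t) <= L * Rabs (s - t)).
  { intros s t. apply le_epsilon. intros eps He.
    destruct (filter_ex (F := G) _ (filter_and (F := G) _ _ (Hw s (eps / 2) ltac:(lra)) (Hw t (eps / 2) ltac:(lra))))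
      as [n [H1 H2]].
    specialize (Hlip n s t). revert H1 H2 Hlip. generalize (L * Rabs (s - t)).
    unfold Rabs; repeat destruct Rcase_abs; intros; lra. }
  split; [exact Hwl|]. intros eps N He.
  (* The mesh [d = T / (m + 1)] is so fine that all functions vary by at most [eps / 3] between
     neighbouring net points. *)
  destruct (nfloor_ex (3 * L * T / eps)) as [m [_ Hm]].
  { apply Rlt_le, Rdiv_lt_0_compat; [|lra]. repeat apply Rmult_lt_0_compat; lra. }
  set (d := T / (INR m + 1)).
  assert (HIm := pos_INR m).
  assert (Hd : 0 < d) by (apply Rdiv_lt_0_compat; lra).
  assert (HLd : L * d <= eps / 3).
  { unfold d. apply Rmult_lt_compat_r with (r := eps) in Hm; [|lra].
    unfold Rdiv in Hm at 1. rewrite Rmult_assoc, Rinv_l, Rmult_1_r in Hm by lra.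
    apply Rmult_le_reg_r with (INR m + 1); [lra|].
    replace (L * (T / (INR m + 1)) * (INR m + 1)) with (L * T) by (field; lra). lra. }
  (* Closeness at finitely many net points is a finite intersection of members of [G]. *)
  assert (Hnet : forall k, G (fun n => forall i, (i <= k)%nat ->
                   Rabs (w_ n (INR i * d) - w (INR i * d)) < eps / 3)).
  { induction k as [|k IH].
    - generalize (Hw (INR 0 * d) (eps / 3) ltac:(lra)). apply filter_imp. intros n Hn i Hi.
      now replace i with 0%nat by lia.
    - generalize (filter_and (F := G) _ _ IH (Hw (INR (S k) * d) (eps / 3) ltac:(lra))).
      apply filter_imp. intros n [H1 H2] i Hi.
      destruct (Nat.eq_dec i (S k)) as [->|]; [exact H2|]. apply H1; lia. }
  assert (HN : G (fun n => (N <= n)%nat)) by (apply HE; now exists N).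
  assert (Hwc : forall t, w t = w (clamp T t)).
  { intros t. apply Rminus_diag_uniq, Rabs_eq_0, Rle_antisym; [|apply Rabs_pos].
    apply le_epsilon. intros e Hep.
    destruct (filter_ex (F := G) _ (filter_and (F := G) _ _ (Hw t (e / 2) ltac:(lra))
      (Hw (clamp T t) (e / 2) ltac:(lra)))) as [n [H1 H2]].
    rewrite <- Hcl in H2. revert H1 H2.
    unfold Rabs; repeat destruct Rcase_abs; intros; lra. }
  destruct (filter_ex (F := G) _ (filter_and (F := G) _ _ HN (Hnet (S m)))) as [n [Hn1 Hn2]].
  exists n. split; [exact Hn1|]. intros t. rewrite Hcl, Hwc.
  pose proof (clamp_bounds T t ltac:(lra)) as Hs. set (s := clamp T t) in *.
  (* The net point [i * d] just left of [s]; the index [S m] occurs when [s = T]. The three errors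
     of [eps / 3] come from [w_ n], the net point and [w]. *)
  destruct (nfloor_ex (s / d)) as [i Hi]. { apply Rdiv_le_0_compat; lra. }
  assert (Hsd : s = s / d * d) by (field; lra).
  assert (Hi2 : (i <= S m)%nat).
  { apply INR_le. rewrite S_INR. apply Rmult_le_reg_r with d; [lra|].
    replace ((INR m + 1) * d) with T by (unfold d; field; lra). nra. }
  specialize (Hn2 i Hi2).
  assert (Hsi : Rabs (s - INR i * d) <= d) by (apply Rabs_le; split; nra).
  pose proof (Hlip n s (INR i * d)) as H1. pose proof (Hwl s (INR i * d)) as H2.
  assert (L * Rabs (s - INR i * d) <= eps / 3).
  { apply Rle_trans with (2 := HLd). apply Rmult_le_compat_l; lra. }
  revert Hn2 H1 H2 H. generalize (L * Rabs (s - INR i * d)).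
  unfold Rabs; repeat destruct Rcase_abs; intros; lra.
Qed.

(** * The delay equation *)

Lemma le_scaled_epsilon (K x y : R) :
  0 <= K -> (forall e, 0 < e -> x <= y + K * e) -> x <= y.
Proof.
  intros HK H. apply le_epsilon. intros e He.
  specialize (H (e / (K + 1)) ltac:(apply Rdiv_lt_0_compat; lra)).
  enough (K * (e / (K + 1)) <= e) by lra.
  apply Rmult_le_reg_r with (K + 1); [lra|].
  replace (K * (e / (K + 1)) * (K + 1)) with (K * e) by (field; lra). nra.
Qed.

Definition defect (T eta alpha : R) (w : R -> R) : R := w T - alpha * RInt w 0 eta.

Lemma defect_close (T eta alpha e : R) (v w : R -> R) :
  0 <= eta -> 0 <= alpha -> (forall x, continuous v x) -> (forall x, continuous w x) ->
  (forall t, Rabs (v t - w t) <= e) ->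
  Rabs (defect T eta alpha v - defect T eta alpha w) <= (1 + alpha * eta) * e.
Proof.
  intros Heta Halpha Hv Hw He. unfold defect.
  replace (_ - _ - _) with ((v T - w T) - alpha * (RInt v 0 eta - RInt w 0 eta)) by ring.
  rewrite <- RInt_minus_cont by auto.
  pose proof (He T) as H1.
  pose proof (RInt_bounds (fun x => v x - w x) 0 eta (- e) e Heta) as H2.
  destruct H2 as [H2 H3].
  { intros x. apply (continuous_minus (V := R_NormedModule)); auto. }
  { intros x _. now apply Rabs_le_between. }
  apply Rabs_le_between in H1. apply Rabs_le. rewrite Rminus_0_r in *. split; nra.
Qed.

(** * The integral in the denominator of [Lambda2] *)

Definition kernel_integral (T eta alpha : R) (a : R -> R) : R :=
  RInt (fun s => (T - s) * a s) eta T
  + / 2 * RInt (fun s => (2 * (T - eta) + alpha * (eta ^ 2 - s ^ 2)) * a s) 0 eta.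

(** Repeated integration by parts, with [a1], [a2], [a3] the successive antiderivatives of [a] that
    vanish at 0. *)
Lemma kernel_integral_antiderivatives (T eta alpha : R) (a a1 a2 a3 : R -> R) :
  (forall x, continuous a x) -> (forall x, is_derive a1 x (a x)) ->
  (forall x, is_derive a2 x (a1 x)) -> (forall x, is_derive a3 x (a2 x)) ->
  a1 0 = 0 -> a2 0 = 0 -> a3 0 = 0 ->
  kernel_integral T eta alpha a = a2 T - alpha * a3 eta - (1 - alpha * eta) * a2 eta.
Proof.
  intros Ha H1 H2 H3 H10 H20 H30. unfold kernel_integral.
  assert (D1 : forall x, Derive (fun t => a1 t) x = a x) by (intros; apply is_derive_unique, H1).
  assert (D2 : forall x, Derive (fun t => a2 t) x = a1 x) by (intros; apply is_derive_unique, H2).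
  assert (D3 : forall x, Derive (fun t => a3 t) x = a2 x) by (intros; apply is_derive_unique, H3).
  rewrite (RInt_antiderivative (fun s => (T - s) * a1 s + a2 s)).
  rewrite (RInt_antiderivative (fun s => (2 * (T - eta) + alpha * (eta ^ 2 - s ^ 2)) * a1 s
             + 2 * alpha * s * a2 s - 2 * alpha * a3 s)).
  - rewrite H10, H20, H30. field.
  - intros x. auto_derive.
    + repeat split; eexists; eauto.
    + rewrite D1, D2, D3. ring.
  - intros x. apply (continuous_mult (K := R_AbsRing)); [|apply Ha].
    apply (@ex_derive_continuous R_AbsRing R_NormedModule). now auto_derive.
  - intros x. auto_derive.
    + repeat split; eexists; eauto.
    + rewrite D1, D2. ring.
  - intros x. apply (continuous_mult (K := R_AbsRing)); [|apply Ha].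
    apply (@ex_derive_continuous R_AbsRing R_NormedModule). now auto_derive.
Qed.

(** Links [Lambda2] with the defect: the first two terms are what [solution_defect] subtracts for
    the source [a], and [iint a eta] is nonnegative when [a] is. *)
Lemma kernel_integral_iint (T eta alpha : R) (a : R -> R) :
  (forall x, continuous a x) ->
  kernel_integral T eta alpha a
    = iint a T - alpha * RInt (iint a) 0 eta - (1 - alpha * eta) * iint a eta.
Proof.
  intros Ha.
  apply (kernel_integral_antiderivatives T eta alpha a (fun t => RInt a 0 t) (iint a)
    (fun t => RInt (iint a) 0 t)); try exact (@RInt_point R_CompleteNormedModule _ _); try exact Ha.
  - intros; now apply is_derive_RInt_cont.
  - intros; now apply is_derive_iint.
  - intros; apply is_derive_RInt_cont; now apply iint_continuous.
Qed.

(** As [alpha] times the integral of [iint a] over [[0, eta]] is at most [alpha * eta * iint a eta],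
    the value is at least [iint a T - iint a eta]. This is positive because [a] has positive
    integral over [[0, r]] for some [r] in [[eta, T)]. *)
Lemma kernel_integral_pos (T eta alpha t0 : R) (a : R -> R) :
  0 < eta < T -> 0 < alpha -> alpha * eta < 1 ->
  (forall x, continuous a x) -> (forall x, 0 <= x <= T -> 0 <= a x) ->
  0 <= t0 <= T -> 0 < a t0 ->
  0 < kernel_integral T eta alpha a.
Proof.
  intros Heta Halpha Hae Ha Ha0 Ht0 Hat0. rewrite kernel_integral_iint by exact Ha.
  assert (Hpq : exists p q, 0 <= p < q /\ q < T /\ forall x, p < x < q -> 0 < a x).
  { destruct (proj1 (filterlim_locally a (a t0)) (Ha t0) (mkposreal _ Hat0)) as [d Hd].
    pose proof (cond_pos d) as Hdp.
    assert (Hpos : forall x, Rabs (x - t0) < d -> 0 < a x).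
    { intros x Hx. specialize (Hd x Hx). change (Rabs (a x - a t0) < a t0) in Hd.
      apply Rabs_lt_between in Hd. lra. }
    (* The interval is taken to the left of [t0] if [t0 = T] and to the right otherwise; a midpoint
       as right end keeps it away from [T]. *)
    destruct (Rle_lt_dec T t0) as [H|H].
    - exists (Rmax 0 (T - d)), ((Rmax 0 (T - d) + T) / 2).
      assert (0 <= Rmax 0 (T - d) < T /\ T - d <= Rmax 0 (T - d))
        by (unfold Rmax; destruct Rle_dec; lra).
      repeat split; try lra. intros x Hx. apply Hpos, Rabs_lt_between. lra.
    - exists t0, ((t0 + Rmin T (t0 + d)) / 2).
      assert (t0 < Rmin T (t0 + d) <= T /\ Rmin T (t0 + d) <= t0 + d)
        by (unfold Rmin; destruct Rle_dec; lra).
      repeat split; try lra. intros x Hx. apply Hpos, Rabs_lt_between. lra. }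
  destruct Hpq as [p [q [Hpq [HqT Hpos]]]].
  assert (Hq : 0 < RInt a 0 q).
  { rewrite (RInt_split a 0 p q) by exact Ha.
    assert (0 <= RInt a 0 p).
    { apply RInt_ge_0; [lra|now apply ex_RInt_cont|]. intros; apply Ha0; lra. }
    assert (0 < RInt a p q); [|lra].
    apply RInt_gt_0; [lra|exact Hpos|intros; apply Ha]. }
  set (r := Rmax q eta).
  assert (Hr : q <= r /\ eta <= r < T) by (unfold r, Rmax; destruct Rle_dec; lra).
  pose proof (RInt_nondecreasing a T Ha Ha0 q r ltac:(lra) ltac:(lra) ltac:(lra)) as H1.
  pose proof (proj1 (iint_increment a T Ha Ha0 r T ltac:(lra) ltac:(lra) ltac:(lra))) as H2.
  pose proof (iint_nondecreasing a T Ha Ha0 eta r ltac:(lra) ltac:(lra) ltac:(lra)) as H3.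
  pose proof (proj2 (RInt_iint_le a T Ha Ha0 eta ltac:(lra))) as H4.
  assert (0 < (T - r) * RInt a 0 r) by (apply Rmult_lt_0_compat; lra).
  apply (Rmult_le_compat_l alpha) in H4; [|lra].
  rewrite <- Rmult_assoc in H4. lra.
Qed.

(** * The delayed integral equation with a bounded, uniformly continuous nonlinearity *)

Section delay.
Context (T Ka Kg : R) (a g : R -> R).
Context (T_pos : 0 < T) (a_cont : forall x, continuous a x)
  (a_bounds : forall t, 0 <= a t <= Ka) (g_bounds : forall x, 0 <= g x <= Kg)
  (g_unif : forall eps, 0 < eps ->
    exists d, 0 < d /\ forall x y, Rabs (x - y) < d -> Rabs (g x - g y) < eps).

Definition source (h : R) (w : R -> R) (s : R) : R := a s * g (w (s - h)).

(** Clamping makes the image equal to [c] for [t <= 0], which is the history that the delay calls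
    for, and constant beyond [T]. *)
Definition delay_map (h c : R) (w : R -> R) (t : R) : R := c - iint (source h w) (clamp T t).

Lemma source_continuous (h : R) (w : R -> R) :
  (forall x, continuous w x) -> forall x, continuous (source h w) x.
Proof using a_cont g_unif.
  intros Hw x. apply (continuous_mult (K := R_AbsRing) a (fun s => g (w (s - h)))); [apply a_cont|].
  apply (continuous_comp (fun s => w (s - h)) g).
  - apply (continuous_comp (fun s => s - h) w); [|apply Hw].
    apply (continuous_minus (V := R_NormedModule)); [apply continuous_id|apply continuous_const].
  - apply continuous_eps. intros eps He. destruct (g_unif eps He) as [d [Hd Hg]].
    exists d. split; [exact Hd|]. intros y Hy. now apply Hg.
Qed.

Lemma source_bounds (h : R) (w : R -> R) (s : R) : 0 <= source h w s <= Ka * Kg.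
Proof using a_bounds g_bounds.
  unfold source. pose proof (a_bounds s). pose proof (g_bounds (w (s - h))).
  split; [apply Rmult_le_pos|apply Rmult_le_compat]; lra.
Qed.

Lemma source_abs_le (h : R) (w : R -> R) (s : R) : Rabs (source h w s) <= Ka * Kg.
Proof using a_bounds g_bounds.
  pose proof (source_bounds h w s). rewrite Rabs_pos_eq; lra.
Qed.

Lemma source_close (h h' e : R) (v w : R -> R) (s : R) :
  Rabs (g (v (s - h)) - g (w (s - h'))) <= e -> Rabs (source h v s - source h' w s) <= Ka * e.
Proof using a_bounds.
  intros He. unfold source. rewrite <- Rmult_minus_distr_l, Rabs_mult.
  pose proof (a_bounds s). rewrite (Rabs_pos_eq (a s)) by lra.
  apply Rmult_le_compat; try lra. apply Rabs_pos.
Qed.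

Lemma delay_map_lipschitz (h c : R) (w : R -> R) (s t : R) :
  (forall x, continuous w x) ->
  Rabs (delay_map h c w s - delay_map h c w t) <= T * (Ka * Kg) * Rabs (s - t).
Proof using a_cont a_bounds g_bounds g_unif T_pos.
  intros Hw. unfold delay_map.
  replace (_ - _ - _) with (iint (source h w) (clamp T t) - iint (source h w) (clamp T s)) by ring.
  eapply Rle_trans.
  { apply iint_lipschitz with (B := Ka * Kg); auto using source_continuous, source_abs_le;
      apply clamp_bounds; lra. }
  apply Rmult_le_compat_l.
  { pose proof (source_bounds h w 0). apply Rmult_le_pos; lra. }
  rewrite (Rabs_minus_sym s t). apply clamp_lip; lra.
Qed.

(** Closeness is measured on the delayed values of [g], and the delays may differ: this covers both
    continuous dependence on [c] and the passage to delay 0. *)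
Lemma delay_map_close (h h' c c' e e' : R) (v w : R -> R) (t : R) :
  (forall x, continuous v x) -> (forall x, continuous w x) ->
  Rabs (c - c') <= e -> (forall s, Rabs (g (v (s - h)) - g (w (s - h'))) <= e') ->
  Rabs (delay_map h c v t - delay_map h' c' w t) <= e + T * T * (Ka * e').
Proof using a_cont a_bounds g_unif T_pos.
  intros Hv Hw Hc Hg. unfold delay_map.
  replace (_ - _ - _) with ((c - c') -
    (iint (source h v) (clamp T t) - iint (source h' w) (clamp T t))) by ring.
  rewrite <- iint_minus by now apply source_continuous.
  eapply Rle_trans; [apply Rabs_triang|]. rewrite Rabs_Ropp.
  apply Rplus_le_compat; [exact Hc|].
  apply iint_abs_le.
  - intros x. apply (continuous_minus (V := R_NormedModule)); now apply source_continuous.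
  - intros s _. now apply source_close.
  - apply clamp_bounds; lra.
Qed.

Lemma delay_map_0 (h c : R) (w : R -> R) : delay_map h c w 0 = c.
Proof using T_pos. unfold delay_map. rewrite clamp_neg, iint_0 by lra. ring. Qed.

Definition delay_iter (h c : R) (k : nat) : R -> R := Nat.iter k (delay_map h c) (fun _ => c).

Lemma delay_iter_continuous (h c : R) (k : nat) (t : R) : continuous (delay_iter h c k) t.
Proof using a_cont a_bounds g_bounds g_unif T_pos.
  revert t. induction k as [|k IH]; intros t; [apply continuous_const|].
  apply lipschitz_continuous with (T * (Ka * Kg)). intros x y. now apply delay_map_lipschitz.
Qed.

(* Each iteration extends the exact solution of the delay equation by one delay (method of steps). *)
Lemma delay_iter_stationary (h c : R) (k : nat) (t : R) :
  0 < h -> t <= INR k * h -> delay_iter h c (S k) t = delay_iter h c k t.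
Proof using T_pos.
  intros Hh. revert t. induction k as [|k IH]; intros t Ht.
  - simpl in *. unfold delay_map. rewrite clamp_neg, iint_0 by lra. ring.
  - change (delay_map h c (delay_iter h c (S k)) t = delay_map h c (delay_iter h c k) t).
    unfold delay_map. f_equal. apply iint_ext; [apply clamp_bounds; lra|].
    intros s Hs. unfold source. rewrite IH; [reflexivity|].
    rewrite S_INR in Ht.
    destruct (Rle_dec t 0) as [H|H]; [rewrite clamp_neg in Hs by lra; lra|].
    pose proof (clamp_le T t). nra.
Qed.

(** After [k] steps of length [h] all of [[0, T]] is covered; beyond [T] both sides are constant. *)
Lemma delay_iter_fixed (h c : R) (k : nat) (t : R) :
  0 < h -> T <= INR k * h -> delay_iter h c k t = delay_map h c (delay_iter h c k) t.
Proof using T_pos.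
  intros Hh HT.
  assert (H : forall s, s <= T -> delay_iter h c k s = delay_map h c (delay_iter h c k) s).
  { intros s Hs. symmetry. apply (delay_iter_stationary h c k s); lra. }
  destruct (Rle_dec t T) as [Ht|Ht]; [now apply H|].
  destruct k as [|k]; [simpl in HT; lra|].
  assert (Hcl : clamp T t = clamp T T)
    by (unfold clamp, Rmax, Rmin; repeat destruct Rle_dec; lra).
  transitivity (delay_iter h c (S k) T).
  - change (delay_map h c (delay_iter h c k) t = delay_map h c (delay_iter h c k) T).
    unfold delay_map. now rewrite Hcl.
  - rewrite H by lra. unfold delay_map. now rewrite Hcl.
Qed.

(** Induction on [k]: uniform continuity of [g] turns uniform closeness of two iterates into
    closeness of their sources. *)
Lemma delay_iter_continuous_start (h c : R) (k : nat) (eps : R) :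
  0 < eps -> exists d, 0 < d /\ forall c', Rabs (c' - c) < d ->
    forall t, Rabs (delay_iter h c' k t - delay_iter h c k t) <= eps.
Proof using a_cont a_bounds g_bounds g_unif T_pos.
  revert eps. induction k as [|k IH]; intros eps He.
  - exists eps. split; [exact He|]. intros c' Hc t. apply Rlt_le, Hc.
  - pose proof (a_bounds 0) as Ha.
    assert (HK : 0 <= T * T * Ka) by (repeat apply Rmult_le_pos; lra).
    (* Chosen so that the bound [e + T * T * (Ka * e)] of [delay_map_close] equals [eps]. *)
    set (e := eps / (1 + T * T * Ka)).
    assert (Hee : 0 < e) by (apply Rdiv_lt_0_compat; lra).
    destruct (g_unif e Hee) as [d1 [Hd1 Hg]].
    destruct (IH (d1 / 2) ltac:(lra)) as [d2 [Hd2 Hw]].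
    exists (Rmin e d2). split; [now apply Rmin_glb_lt|]. intros c' Hc t.
    replace eps with (e + T * T * (Ka * e)) by (unfold e; field; lra).
    apply (delay_map_close h h c' c e e); try (intros x; apply delay_iter_continuous).
    + apply Rlt_le, Rlt_le_trans with (1 := Hc), Rmin_l.
    + intros s. apply Rlt_le, Hg. apply Rle_lt_trans with (d1 / 2); [|lra].
      apply Hw. apply Rlt_le_trans with (1 := Hc), Rmin_r.
Qed.

(** * Shooting in the initial value and the limit of vanishing delay *)

Section shooting.
Context (eta alpha : R) (eta_ge0 : 0 <= eta) (alpha_ge0 : 0 <= alpha).

Lemma defect_continuous_start (h : R) (k : nat) :
  continuity (fun c => defect T eta alpha (delay_iter h c k)).
Proof using a_cont a_bounds g_bounds g_unif T_pos eta_ge0 alpha_ge0.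
  intros c. apply continuity_pt_filterlim, continuous_eps. intros eps He.
  assert (HK : 0 <= alpha * eta) by (apply Rmult_le_pos; lra).
  set (e := eps / (1 + alpha * eta)).
  assert (Hee : 0 < e) by (apply Rdiv_lt_0_compat; lra).
  destruct (delay_iter_continuous_start h c k (e / 2) ltac:(lra)) as [d [Hd Hw]].
  exists d. split; [exact Hd|]. intros c' Hc.
  apply Rle_lt_trans with ((1 + alpha * eta) * (e / 2)).
  - apply defect_close; auto using delay_iter_continuous.
  - replace eps with ((1 + alpha * eta) * e) by (unfold e; field; lra). nra.
Qed.

(** Intermediate values for each delay, then a cluster point as the delay tends to 0. [Rmin] and
    [Rmax] allow [p] on either side of [q]. *)
Lemma shooting_solution (p q : R) :
  (forall h w, 0 <= h -> (forall x, continuous w x) -> (forall t, w t = delay_map h p w t) ->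
     0 <= defect T eta alpha w) ->
  (forall h w, 0 <= h -> (forall x, continuous w x) -> (forall t, w t = delay_map h q w t) ->
     defect T eta alpha w <= 0) ->
  exists c w, Rmin p q <= c <= Rmax p q /\ (forall x, continuous w x) /\
    (forall t, w t = delay_map 0 c w t) /\ defect T eta alpha w = 0.
Proof using a_cont a_bounds g_bounds g_unif T_pos eta_ge0 alpha_ge0.
  intros Hp Hq.
  (* With this delay, [S n] steps cover [[0, T]] exactly. *)
  set (h := fun n : nat => T / (INR n + 1)).
  assert (Hh : forall n, 0 < h n).
  { intros n. apply Rdiv_lt_0_compat; [lra|]. pose proof (pos_INR n); lra. }
  assert (Hfix : forall n c t, delay_iter (h n) c (S n) t
                   = delay_map (h n) c (delay_iter (h n) c (S n)) t).
  { intros n c t. apply delay_iter_fixed; [apply Hh|]. apply Req_le. unfold h.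
    rewrite S_INR. field. pose proof (pos_INR n); lra. }
  assert (Hc : forall n, exists c, Rmin p q <= c <= Rmax p q /\
            defect T eta alpha (delay_iter (h n) c (S n)) = 0).
  { intros n. destruct (IVT_gen _ p q 0 (defect_continuous_start (h n) (S n))) as [c Hc].
    - specialize (Hp (h n) _ (Rlt_le _ _ (Hh n)) (delay_iter_continuous _ _ _) (Hfix n p)).
      specialize (Hq (h n) _ (Rlt_le _ _ (Hh n)) (delay_iter_continuous _ _ _) (Hfix n q)).
      rewrite Rmin_right, Rmax_left by lra. lra.
    - now exists c. }
  apply functional_choice in Hc. destruct Hc as [c_ Hc].
  set (w_ := fun n => delay_iter (h n) (c_ n) (S n)).
  pose proof (source_bounds 0 (fun _ => 0) 0) as HKK.
  pose proof (a_bounds 0) as HKa.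
  assert (HL : 0 <= T * (Ka * Kg)) by (apply Rmult_le_pos; lra).
  (* The summand 1 makes the Lipschitz constant strictly positive. *)
  set (L := T * (Ka * Kg) + 1).
  assert (Hlip : forall n s t, Rabs (w_ n s - w_ n t) <= L * Rabs (s - t)).
  { intros n s t. unfold w_. rewrite (Hfix n _ s), (Hfix n _ t).
    eapply Rle_trans; [apply delay_map_lipschitz, delay_iter_continuous|].
    apply Rmult_le_compat_r; [apply Rabs_pos|unfold L; lra]. }
  assert (Hw0 : forall n, w_ n 0 = c_ n).
  { intros n. unfold w_. rewrite Hfix. apply delay_map_0. }
  assert (Hcl : forall n t, w_ n t = w_ n (clamp T t)).
  { intros n t. unfold w_. rewrite (Hfix n _ t), (Hfix n _ (clamp T t)). unfold delay_map.
    now rewrite (clamp_id T (clamp T t)) by (apply clamp_bounds; lra). }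
  destruct (equilipschitz_cluster T L (Rmax (Rabs p) (Rabs q) + L * T) w_) as [w [Hwl Hw]]; auto.
  { unfold L; lra. }
  { intros n t. rewrite Hcl. replace (w_ n (clamp T t)) with (c_ n + (w_ n (clamp T t) - w_ n 0))
      by (rewrite Hw0; ring).
    eapply Rle_trans; [apply Rabs_triang|]. apply Rplus_le_compat.
    - destruct (Hc n) as [H _]. revert H. unfold Rmin, Rmax, Rabs.
      repeat destruct Rle_dec; repeat destruct Rcase_abs; lra.
    - eapply Rle_trans; [apply Hlip|]. apply Rmult_le_compat_l; [unfold L; lra|].
      pose proof (clamp_bounds T t ltac:(lra)). rewrite Rminus_0_r, Rabs_pos_eq; lra. }
  assert (Hwc : forall x, continuous w x) by now apply lipschitz_continuous with L.
  assert (Hwnc : forall n x, continuous (w_ n) x) by (intros; apply delay_iter_continuous).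
  assert (Hc0 : forall e, 0 < e -> exists n, Rabs (c_ n - w 0) <= e).
  { intros e He. destruct (Hw e 0%nat He) as [n [_ Hn]]. exists n. rewrite <- Hw0. apply Hn. }
  exists (w 0), w. split; [split|split; [exact Hwc|split]].
  - apply le_epsilon. intros e He. destruct (Hc0 e He) as [n Hn].
    apply Rabs_le_between in Hn. destruct (Hc n) as [H _]. lra.
  - apply le_epsilon. intros e He. destruct (Hc0 e He) as [n Hn].
    apply Rabs_le_between in Hn. destruct (Hc n) as [H _]. lra.
  - intros t. apply Rminus_diag_uniq, Rabs_eq_0, Rle_antisym; [|apply Rabs_pos].
    (* One [e] for [w_ n t] against [w t], one for [c_ n] against [w 0], and [T * T * Ka * e] for
       the sources. *)
    apply le_scaled_epsilon with (2 + T * T * Ka).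
    { assert (0 <= T * T * Ka) by (repeat apply Rmult_le_pos; lra). lra. }
    intros e He. destruct (g_unif e He) as [d [Hd Hg]].
    (* For [n >= N] the delay shifts [w_ n] by at most [d / 4], so [w_ n (s - h n)] is within
       [d / 2] of [w s]. *)
    destruct (nfloor_ex (L * T / (d / 4))) as [N [_ HN]].
    { apply Rdiv_le_0_compat; [|lra]. apply Rmult_le_pos; unfold L; lra. }
    destruct (Hw (Rmin e (d / 4)) N) as [n [HNn Hn]]. { apply Rmin_glb_lt; lra. }
    assert (Hne : forall s, Rabs (w_ n s - w s) <= e)
      by (intros s; apply Rle_trans with (1 := Hn s), Rmin_l).
    assert (Hnd : forall s, Rabs (w_ n s - w s) <= d / 4)
      by (intros s; apply Rle_trans with (1 := Hn s), Rmin_r).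
    assert (Hhn : L * h n <= d / 4).
    { unfold h. apply le_INR in HNn. pose proof (pos_INR n).
      apply Rmult_le_reg_r with (INR n + 1); [lra|].
      replace (L * (T / (INR n + 1)) * (INR n + 1)) with (L * T / (d / 4) * (d / 4)) by (field; lra).
      rewrite (Rmult_comm (d / 4)). apply Rmult_le_compat_r; lra. }
    assert (H1 : Rabs (w_ n t - delay_map 0 (w 0) w t) <= e + T * T * (Ka * e)).
    { unfold w_. rewrite Hfix. apply delay_map_close; auto; try (intros x; apply delay_iter_continuous).
      - rewrite <- Hw0. apply Hne.
      - intros s. apply Rlt_le, Hg. fold (w_ n). rewrite Rminus_0_r.
        pose proof (Hlip n (s - h n) s) as H1. pose proof (Hnd s) as H2.
        replace (s - h n - s) with (- h n) in H1 by ring.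
        rewrite Rabs_Ropp, (Rabs_pos_eq (h n)) in H1 by (apply Rlt_le, Hh).
        revert H1 H2. unfold Rabs; repeat destruct Rcase_abs; lra. }
    specialize (Hne t). revert H1 Hne.
    replace ((2 + T * T * Ka) * e) with (2 * e + T * T * (Ka * e)) by ring.
    generalize (T * T * (Ka * e)).
    unfold Rabs; repeat destruct Rcase_abs; intros; lra.
  - apply Rabs_eq_0, Rle_antisym; [|apply Rabs_pos].
    apply le_scaled_epsilon with (1 + alpha * eta).
    { assert (0 <= alpha * eta) by now apply Rmult_le_pos. lra. }
    intros e He. destruct (Hw e 0%nat He) as [n [_ Hn]].
    destruct (Hc n) as [_ Hdn]. fold (w_ n) in Hdn.
    pose proof (defect_close T eta alpha e (w_ n) w eta_ge0 alpha_ge0 (Hwnc n) Hwc Hn) as H.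
    rewrite Hdn, Rminus_0_l, Rabs_Ropp in H. lra.
Qed.

End shooting.

(** * Sign of the defect *)

Section nonlocal_condition.
Context (eta alpha : R) (eta_bounds : 0 < eta < T) (alpha_pos : 0 < alpha)
  (alpha_eta : alpha * eta < 1).

(** [alpha * eta ^ 2 < eta < T]. *)
Lemma gamma_denominator_pos : 0 < T - alpha * eta ^ 2.
Proof using eta_bounds alpha_eta. simpl. nra. Qed.

Lemma gamma_pos : 0 < gamma_c T eta alpha.
Proof using eta_bounds alpha_pos alpha_eta.
  unfold gamma_c. apply Rdiv_lt_0_compat; [|apply gamma_denominator_pos].
  repeat apply Rmult_lt_0_compat; lra.
Qed.

(** Numerator and denominator share the term [- alpha * eta ^ 2], and [alpha * eta * T < T]. *)
Lemma gamma_lt_1 : gamma_c T eta alpha < 1.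
Proof using eta_bounds alpha_pos alpha_eta T_pos.
  unfold gamma_c. pose proof gamma_denominator_pos as H.
  apply Rmult_lt_reg_r with (T - alpha * eta ^ 2); [exact H|].
  unfold Rdiv. rewrite Rmult_assoc, Rinv_l by lra. simpl. nra.
Qed.

Section solution.
Context (h c : R) (w : R -> R) (w_cont : forall x, continuous w x)
  (w_eq : forall t, w t = delay_map h c w t).

Let y_cont : forall x, continuous (source h w) x := source_continuous h w w_cont.

Let y_ge0 (x : R) (_ : 0 <= x <= T) : 0 <= source h w x := proj1 (source_bounds h w x).

Lemma solution_eq (t : R) : 0 <= t <= T -> w t = c - iint (source h w) t.
Proof using w_eq. intros Ht. rewrite w_eq. unfold delay_map. now rewrite clamp_id. Qed.

Lemma solution_le (t : R) : w t <= c.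
Proof using w_eq y_cont y_ge0 T_pos.
  rewrite w_eq. unfold delay_map.
  pose proof (iint_nonneg _ T y_cont y_ge0 (clamp T t) (clamp_bounds T t ltac:(lra))). lra.
Qed.

Lemma solution_nonincreasing (s t : R) : 0 <= s -> s <= t -> t <= T -> w t <= w s.
Proof using w_eq y_cont y_ge0.
  intros Hs Hst Ht. rewrite (solution_eq s), (solution_eq t) by lra.
  pose proof (iint_nondecreasing _ T y_cont y_ge0 s t Hs Hst Ht). lra.
Qed.

(** Holds on the whole line since [w] factors through [clamp T]; delayed arguments may be
    negative. *)
Lemma solution_ge_end (t : R) : w T <= w t.
Proof using w_eq y_cont y_ge0 T_pos.
  rewrite (w_eq t). unfold delay_map. rewrite <- solution_eq by (apply clamp_bounds; lra).
  pose proof (clamp_bounds T t ltac:(lra)). apply solution_nonincreasing; lra.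
Qed.

(* Concavity puts [w eta] above the chord from [(0, c)] to [(T, w T)], and monotonicity gives
   [w T >= alpha * eta * w eta]. *)
Lemma solution_ge_gamma : 0 <= defect T eta alpha w -> forall t, gamma_c T eta alpha * c <= w t.
Proof using w_eq w_cont y_cont y_ge0 T_pos eta_bounds alpha_pos alpha_eta.
  intros Hd t. apply Rle_trans with (2 := solution_ge_end t).
  pose proof (iint_chord _ T y_cont y_ge0 eta ltac:(lra)) as Hch.
  pose proof (solution_eq eta ltac:(lra)) as H1.
  pose proof (solution_eq T ltac:(lra)) as H2.
  pose proof (RInt_bounds w 0 eta (w eta) c ltac:(lra) w_cont) as [H3 _].
  { intros x Hx; split; [apply solution_nonincreasing; lra|apply solution_le]. }
  unfold defect in Hd. rewrite Rminus_0_r in H3.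
  assert (H4 : alpha * (eta * w eta) <= w T).
  { apply Rle_trans with (alpha * RInt w 0 eta); [apply Rmult_le_compat_l|]; lra. }
  replace (iint (source h w) eta) with (c - w eta) in Hch by lra.
  replace (iint (source h w) T) with (c - w T) in Hch by lra.
  unfold gamma_c. pose proof gamma_denominator_pos as Hp.
  apply Rmult_le_reg_r with (T - alpha * eta ^ 2); [exact Hp|].
  replace (_ / _ * _ * _) with (alpha * eta * (T - eta) * c) by (field; lra).
  (* Adding [alpha * eta] times the chord inequality to [T] times [H4] eliminates [w eta]. *)
  assert (H5 : alpha * eta * (T * (c - w eta)) <= alpha * eta * (eta * (c - w T))).
  { apply Rmult_le_compat_l; [apply Rmult_le_pos; lra|exact Hch]. }
  apply (Rmult_le_compat_l T) in H4; [|lra].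
  replace (w T * (T - alpha * eta ^ 2)) with (T * w T - alpha * eta * eta * w T) by ring. lra.
Qed.

Lemma solution_defect :
  defect T eta alpha w = (1 - alpha * eta) * c
    - (iint (source h w) T - alpha * RInt (iint (source h w)) 0 eta).
Proof using w_eq y_cont eta_bounds T_pos.
  unfold defect. rewrite (solution_eq T) by lra.
  replace (RInt w 0 eta) with (eta * c - RInt (iint (source h w)) 0 eta); [ring|].
  replace (eta * c) with (RInt (fun _ => c) 0 eta : R) by (rewrite RInt_const_R, Rminus_0_r; reflexivity).
  rewrite <- RInt_minus_cont.
  - apply (@RInt_ext R_CompleteNormedModule). intros x Hx.
    rewrite Rmin_left, Rmax_right in Hx by lra. symmetry; apply solution_eq; lra.
  - intros; apply continuous_const.
  - now apply iint_continuous.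
Qed.

(** Since [w <= c], the source is at most [Ka * e * c], so its double integral at [T] is at most
    [(1 - alpha * eta) * c]; the term with [alpha] only raises the defect. *)
Lemma defect_ge0_of_small_source (e : R) :
  0 <= c -> (forall x, x <= c -> g x <= e * c) -> T * T * (Ka * e) <= 1 - alpha * eta ->
  0 <= defect T eta alpha w.
Proof using w_eq y_cont y_ge0 T_pos eta_bounds alpha_pos a_bounds g_bounds.
  intros Hc Hg He. rewrite solution_defect.
  pose proof (RInt_iint_le _ T y_cont y_ge0 eta ltac:(lra)) as [H1 _].
  assert (H2 : Rabs (iint (source h w) T) <= T * T * (Ka * (e * c))).
  { apply iint_abs_le; [exact y_cont| |lra]. intros x Hx. rewrite Rabs_pos_eq by now apply y_ge0.
    pose proof (a_bounds x). pose proof (g_bounds (w (x - h))).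
    apply Rmult_le_compat; try lra. apply Hg, solution_le. }
  apply Rabs_le_between in H2.
  apply (Rmult_le_compat_r c) in He; [|exact Hc].
  assert (0 <= alpha * RInt (iint (source h w)) 0 eta) by (apply Rmult_le_pos; lra). lra.
Qed.

(* With [P >= 0] the double integral of [a * (g - M * c)], the defect is at most
   [(1 - alpha * eta) * c - M * c * kernel_integral], and [M >= Lambda2] makes the second term
   at least [(1 - alpha * eta) * c / gamma], where [gamma < 1]. *)
Lemma defect_lt0_of_large_source (M : R) :
  0 < kernel_integral T eta alpha a -> 0 < c -> Lambda2 T eta alpha a <= M ->
  (forall x, gamma_c T eta alpha * c <= x <= c -> M * c <= g x) ->
  defect T eta alpha w < 0.
Proof using w_eq w_cont y_cont y_ge0 T_pos eta_bounds alpha_pos alpha_eta a_cont a_bounds.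
  (* Assuming a nonnegative defect makes [solution_ge_gamma] available, so that all values of [w]
     lie where [g] is large. *)
  intros HD Hc HM Hg. apply Rnot_le_lt. intros Hd.
  pose proof (solution_ge_gamma Hd) as Hlow.
  pose proof solution_le as Hup.
  pose proof solution_defect as Hdef.
  assert (HMa : forall x, continuous (fun s => M * c * a s) x).
  { intros x. apply (continuous_mult (K := R_AbsRing)); [apply continuous_const|apply a_cont]. }
  set (p := fun s => source h w s - M * c * a s).
  assert (Hp : forall x, continuous p x).
  { intros x. now apply (continuous_minus (V := R_NormedModule)). }
  assert (Hp0 : forall x, 0 <= x <= T -> 0 <= p x).
  { intros x _. unfold p, source. rewrite (Rmult_comm _ (a x)), <- Rmult_minus_distr_l.
    apply Rmult_le_pos; [apply a_bounds|]. specialize (Hg (w (x - h)) (conj (Hlow _) (Hup _))). lra. }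
  assert (Hip : forall t, iint (source h w) t = iint p t + M * c * iint a t).
  { intros t. unfold p. rewrite iint_minus, iint_scal by auto. ring. }
  assert (HRip : RInt (iint (source h w)) 0 eta
                 = RInt (iint p) 0 eta + M * c * RInt (iint a) 0 eta).
  { apply Rminus_eq_reg_r with (M * c * RInt (iint a) 0 eta). ring_simplify.
    rewrite <- RInt_scal_cont, <- RInt_minus_cont; auto using iint_continuous.
    - apply (@RInt_ext R_CompleteNormedModule). intros x _. rewrite Hip. simpl. ring.
    - intros x. apply (continuous_mult (K := R_AbsRing)); [apply continuous_const|].
      now apply iint_continuous. }
  rewrite Hip, HRip in Hdef.
  pose proof (kernel_integral_iint T eta alpha a a_cont) as HK.
  pose proof (iint_nonneg a T a_cont (fun x _ => proj1 (a_bounds x)) eta ltac:(lra)) as HA.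
  pose proof (proj2 (RInt_iint_le p T Hp Hp0 eta ltac:(lra))) as HP1.
  pose proof (iint_nondecreasing p T Hp Hp0 eta T ltac:(lra) ltac:(lra) ltac:(lra)) as HP2.
  pose proof (iint_nonneg p T Hp Hp0 eta ltac:(lra)) as HP3.
  pose proof gamma_pos as Hg0.
  pose proof gamma_lt_1 as Hg1.
  set (D := kernel_integral T eta alpha a) in *.
  change (Lambda2 T eta alpha a) with ((1 - alpha * eta) / (gamma_c T eta alpha * D)) in HM.
  (* [M >= Lambda2] gives [1 - alpha * eta <= gamma * M * D]; strictness comes from [gamma < 1]. *)
  assert (HMD : 1 - alpha * eta < M * D).
  { assert (Hgd : 0 < gamma_c T eta alpha * D) by now apply Rmult_lt_0_compat.
    apply (Rmult_le_compat_r _ _ _ (Rlt_le _ _ Hgd)) in HM.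
    unfold Rdiv in HM. rewrite Rmult_assoc, Rinv_l, Rmult_1_r in HM by lra.
    assert (0 < M * D) by nra. nra. }
  assert (HM0 : 0 < M) by nra.
  assert (HDle : M * c * D <= M * c * (iint a T - alpha * RInt (iint a) 0 eta)).
  { apply Rmult_le_compat_l; [apply Rmult_le_pos; lra|].
    assert (0 <= (1 - alpha * eta) * iint a eta) by (apply Rmult_le_pos; lra). lra. }
  (* [iint p] is nondecreasing and [alpha * eta < 1], so the excess [p] can only lower the
     defect. *)
  assert (HP4 : alpha * RInt (iint p) 0 eta <= iint p T).
  { apply Rle_trans with (alpha * (eta * iint p eta)); [apply Rmult_le_compat_l; lra|].
    rewrite <- Rmult_assoc. nra. }
  apply (Rmult_lt_compat_r c) in HMD; [|exact Hc]. lra.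
Qed.

End solution.
End nonlocal_condition.
End delay.


(** * Back to the boundary value problem *)

Lemma continuous_clamp_comp (D : R -> Prop) (T : R) (f : R -> R) :
  0 <= T -> (forall x, 0 <= x <= T -> D x) -> cont_on D f ->
  forall x, continuous (fun t => f (clamp T t)) x.
Proof.
  intros HT HD Hf x. unfold continuous.
  apply (filterlim_comp _ _ _ (clamp T) f _ (within D (locally (clamp T x)))).
  - intros P HP. generalize (clamp_continuous T x HT _ HP). unfold filtermap. apply filter_imp.
    intros y Hy. apply Hy, HD, clamp_bounds, HT.
  - apply Hf, HD, clamp_bounds, HT.
Qed.

Lemma clamp_comp_bounded (T : R) (f : R -> R) :
  0 <= T -> (forall x, continuous (fun t => f (clamp T t)) x) ->
  exists K, forall t, f (clamp T t) <= K.
Proof.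
  intros HT Hf.
  destruct (continuity_ab_maj (fun t => f (clamp T t)) 0 T HT) as [m [Hm _]].
  { intros c _. apply continuity_pt_filterlim, Hf. }
  exists (f (clamp T m)). intros t.
  rewrite <- (clamp_id T (clamp T t)) by now apply clamp_bounds.
  apply Hm, clamp_bounds, HT.
Qed.

(** Heine's theorem on [[0, T]], carried to the line by the 1-Lipschitz map [clamp T]. *)
Lemma clamp_comp_uniformly_continuous (T : R) (f : R -> R) :
  0 <= T -> (forall x, continuous (fun t => f (clamp T t)) x) ->
  forall eps, 0 < eps -> exists d, 0 < d /\
    forall x y, Rabs (x - y) < d -> Rabs (f (clamp T x) - f (clamp T y)) < eps.
Proof.
  intros HT Hf eps He.
  destruct (@Heine_cor2 _ 0 T (fun c _ => proj2 (continuity_pt_filterlim _ c) (Hf c))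
    (mkposreal eps He)) as [d Hd].
  exists d. split; [apply cond_pos|]. intros x y Hxy.
  rewrite <- (clamp_id T (clamp T x)), <- (clamp_id T (clamp T y)) by now apply clamp_bounds.
  apply (Hd (clamp T x) (clamp T y)); try now apply clamp_bounds.
  apply Rle_lt_trans with (2 := Hxy). now apply clamp_lip.
Qed.

(** * Initial values at which the nonlinearity is small *)

Lemma sublinear_at_0 (f : R -> R) (e b : R) :
  cont_on (fun x => 0 <= x) f -> filterlim (fun x => f x / x) (at_right 0) (locally 0) ->
  0 < e -> 0 < b ->
  exists p, 0 < p < b /\ forall x, 0 <= x <= p -> f x <= e * p.
Proof.
  intros Hc Hf He Hb.
  destruct (proj1 (filterlim_locally _ _) Hf (mkposreal e He)) as [d Hd].
  pose proof (cond_pos d) as Hdp.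
  set (p := Rmin d b / 2).
  assert (Hp : 0 < p < d /\ p < b) by (unfold p, Rmin; destruct Rle_dec; lra).
  assert (Hpos : forall x, 0 < x <= p -> f x <= e * p).
  { intros x Hx.
    assert (Hball : ball 0 d x) by (change (Rabs (x - 0) < d); rewrite Rminus_0_r, Rabs_pos_eq; lra).
    specialize (Hd x Hball ltac:(lra)). change (Rabs (f x / x - 0) < e) in Hd.
    rewrite Rminus_0_r in Hd. apply Rabs_lt_between in Hd. destruct Hd as [_ Hd].
    apply (Rmult_lt_compat_r x) in Hd; [|lra].
    unfold Rdiv in Hd. rewrite Rmult_assoc, Rinv_l, Rmult_1_r in Hd by lra. nra. }
  exists p. split; [lra|]. intros x [Hx0 Hxp].
  destruct Hx0 as [Hx0| <-]; [apply Hpos; lra|].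
  apply Rnot_lt_le. intros Hlt.
  (* The quotient says nothing at [x = 0]; there the bound is inherited by continuity from a small
     [y > 0]. *)
  assert (Heps : 0 < f 0 - e * p) by lra.
  destruct (proj1 (filterlim_locally _ _) (Hc 0 (Rle_refl 0)) (mkposreal _ Heps)) as [d' Hd'].
  pose proof (cond_pos d') as Hdp'.
  set (y := Rmin (d' / 2) p).
  assert (Hy : 0 < y <= p /\ y < d') by (unfold y, Rmin; destruct Rle_dec; lra).
  assert (Hball : ball 0 d' y) by (change (Rabs (y - 0) < d'); rewrite Rminus_0_r, Rabs_pos_eq; lra).
  specialize (Hd' y Hball ltac:(lra)). change (Rabs (f y - f 0) < f 0 - e * p) in Hd'.
  apply Rabs_lt_between in Hd'. specialize (Hpos y ltac:(lra)). lra.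
Qed.

Lemma sublinear_at_infty (f : R -> R) (e b : R) :
  cont_on (fun x => 0 <= x) f ->
  filterlim (fun x => f x / x) (Rbar_locally p_infty) (locally 0) ->
  0 < e -> 0 < b ->
  exists q, b < q /\ forall x, 0 <= x <= q -> f x <= e * q.
Proof.
  intros Hc Hf He Hb.
  destruct (proj1 (filterlim_locally _ _) Hf (mkposreal e He)) as [m Hm].
  set (X := Rmax m b).
  assert (HX : m <= X /\ b <= X) by (unfold X; split; [apply Rmax_l|apply Rmax_r]).
  destruct (clamp_comp_bounded X f ltac:(lra)) as [K HK].
  { apply (continuous_clamp_comp (fun x => 0 <= x)); [lra|intros; lra|exact Hc]. }
  (* [K / e] absorbs the maximum of [f] on [[0, X]], where [f x / x] is not controlled; [X + 1]
     gives [b < q]. *)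
  set (q := Rmax (X + 1) (K / e)).
  assert (Hq : X + 1 <= q /\ K / e <= q) by (unfold q; split; [apply Rmax_l|apply Rmax_r]).
  exists q. split; [lra|]. intros x Hx.
  destruct (Rle_lt_dec x X) as [HxX|HxX].
  - rewrite <- (clamp_id X x) by lra. apply Rle_trans with (1 := HK x).
    replace K with (e * (K / e)) by (field; lra). apply Rmult_le_compat_l; lra.
  - specialize (Hm x ltac:(lra)). change (Rabs (f x / x - 0) < e) in Hm.
    rewrite Rminus_0_r in Hm. apply Rabs_lt_between in Hm. destruct Hm as [_ Hm].
    apply (Rmult_lt_compat_r x) in Hm; [|lra].
    unfold Rdiv in Hm. rewrite Rmult_assoc, Rinv_l, Rmult_1_r in Hm by lra. nra.
Qed.

(** * From the integral equation to (P) *)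

Lemma is_derive_deriv_on (a b : R) (u u' : R -> R) :
  (forall t, is_derive u t (u' t)) -> deriv_on a b u u'.
Proof.
  intros H t _. apply filterlim_locally. intros eps.
  destruct (proj1 (is_derive_Reals _ _ _) (H t) eps (cond_pos eps)) as [d Hd].
  exists d. intros h Hh [Hh0 _]. apply Hd; [exact Hh0|].
  change (Rabs (h - 0) < d) in Hh. now rewrite Rminus_0_r in Hh.
Qed.

Lemma supnorm_nonincreasing (T : R) (u : R -> R) :
  0 <= T -> (forall t, 0 <= t <= T -> 0 <= u t <= u 0) -> supnorm T u = u 0.
Proof.
  intros HT Hu. unfold supnorm.
  rewrite (is_lub_Rbar_unique _ (Finite (u 0))); [reflexivity|]. split.
  - intros y [t [Ht ->]]. simpl. specialize (Hu t Ht). rewrite Rabs_pos_eq; lra.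
  - intros l Hl. apply Hl. exists 0. split; [lra|].
    specialize (Hu 0 ltac:(lra)). rewrite Rabs_pos_eq; lra.
Qed.

Lemma cont_on_of_continuous (D : R -> Prop) (g : R -> R) :
  (forall t, continuous g t) -> cont_on D g.
Proof.
  intros Hg t _ P HP. generalize (Hg t P HP). unfold within. unfold filtermap.
  apply filter_imp. auto.
Qed.

(** The witness is [c - iint y], twice differentiable on the whole line, and not [w], which is
    constant beyond [T] and may have a corner there. As [0 < w <= c <= q], truncating [f] at [q]
    does not change the equation. *)
Lemma positive_solution_of_delay_map (T eta alpha q c Ka Kg : R) (a f w : R -> R) :
  0 < T -> 0 < eta < T -> 0 < alpha -> alpha * eta < 1 ->
  (forall x, continuous (fun t => a (clamp T t)) x) ->
  (forall t, 0 <= a (clamp T t) <= Ka) -> (forall x, 0 <= f (clamp q x) <= Kg) ->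
  (forall eps, 0 < eps -> exists d, 0 < d /\
    forall x y, Rabs (x - y) < d -> Rabs (f (clamp q x) - f (clamp q y)) < eps) ->
  0 < c <= q -> (forall x, continuous w x) ->
  (forall t, w t = delay_map T (fun t => a (clamp T t)) (fun x => f (clamp q x)) 0 c w t) ->
  defect T eta alpha w = 0 ->
  exists u, positive_solution T eta alpha a f u /\ supnorm T u = c.
Proof.
  intros HT Heta Halpha Hae Ha Hab Hfb Hfu Hc Hwc Hw Hd.
  set (y := source (fun t => a (clamp T t)) (fun x => f (clamp q x)) 0 w).
  assert (Hy : forall x, continuous y x) by now apply source_continuous.
  set (u := fun t => c - iint y t).
  assert (Hwu : forall t, 0 <= t <= T -> w t = u t).
  { intros t Ht. exact (solution_eq T _ _ 0 c w Hw t Ht). }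
  assert (Hu1 : forall t, is_derive u t (- RInt y 0 t)).
  { intros t. rewrite <- Rminus_0_l.
    apply (is_derive_minus (K := R_AbsRing) (V := R_NormedModule) (fun _ => c) (iint y)).
    - apply @is_derive_const.
    - now apply is_derive_iint. }
  assert (Hu2 : forall t, is_derive (fun t => - RInt y 0 t) t (- y t)).
  { intros t. apply (is_derive_opp (K := R_AbsRing) (V := R_NormedModule)).
    now apply is_derive_RInt_cont. }
  pose proof (gamma_pos T eta alpha Heta Halpha Hae) as Hg.
  (* A zero defect is nonnegative, so [w >= gamma * c > 0]. *)
  assert (Hlow : forall t, 0 < w t).
  { intros t. apply Rlt_le_trans with (gamma_c T eta alpha * c); [apply Rmult_lt_0_compat; lra|].
    apply (solution_ge_gamma T Ka Kg _ _ HT Ha Hab Hfb Hfu eta alpha Heta Halpha Hae 0 c w Hwc Hw).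
    lra. }
  assert (Hup : forall t, w t <= c)
    by exact (solution_le T Ka Kg _ _ HT Ha Hab Hfb Hfu 0 c w Hwc Hw).
  assert (Hu0 : u 0 = c) by (unfold u; rewrite iint_0; ring).
  exists u. split; [split; [|split]|].
  - exists (fun t => - RInt y 0 t), (fun t => - y t).
    split; [split; [|split]|split; [|split]].
    + now apply is_derive_deriv_on.
    + now apply is_derive_deriv_on.
    + apply cont_on_of_continuous. intros t. apply (continuous_opp (V := R_NormedModule)), Hy.
    + intros t Ht. rewrite <- Hwu by lra. unfold y, source. rewrite Rminus_0_r.
      rewrite (clamp_id T t) by lra.
      rewrite (clamp_id q (w t)) by (specialize (Hlow t); specialize (Hup t); lra). ring.
    + rewrite (@RInt_point R_CompleteNormedModule). apply Ropp_0.
    + unfold defect in Hd. rewrite <- Hwu by lra.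
      rewrite (@RInt_ext R_CompleteNormedModule u w); [lra|].
      intros t Ht. rewrite Rmin_left, Rmax_right in Ht by lra. symmetry. apply Hwu; lra.
  - intros t Ht. rewrite <- Hwu by exact Ht. apply Rlt_le, Hlow.
  - exists 0. split; lra.
  - rewrite supnorm_nonincreasing; [exact Hu0|lra|].
    intros t Ht. rewrite Hu0, <- Hwu by exact Ht. split; [apply Rlt_le, Hlow|apply Hup].
Qed.

Lemma kernel_integral_ext (T eta alpha : R) (a b : R -> R) :
  0 < eta < T -> (forall t, 0 <= t <= T -> a t = b t) ->
  kernel_integral T eta alpha a = kernel_integral T eta alpha b.
Proof.
  intros Heta Hab. unfold kernel_integral. f_equal; [|f_equal];
    apply (@RInt_ext R_CompleteNormedModule); intros t Ht;
    rewrite Rmin_left, Rmax_right in Ht by lra; rewrite Hab by lra; reflexivity.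
Qed.

Theorem theorem4p2 (T eta alpha : R) (f a : R -> R) (t0 rho2 M2 : R) :
  0 < T -> 0 < eta < T -> 0 < alpha < / eta ->
  cont_on (fun x => 0 <= x) f -> (forall x, 0 <= x -> 0 <= f x) ->
  cont_on (fun t => 0 <= t <= T) a -> (forall t, 0 <= t <= T -> 0 <= a t) ->
  0 <= t0 <= T -> 0 < a t0 ->
  filterlim (fun x => f x / x) (at_right 0) (locally 0) ->
  filterlim (fun x => f x / x) (Rbar_locally p_infty) (locally 0) ->
  0 < rho2 -> Lambda2 T eta alpha a <= M2 ->
  (forall x, gamma_c T eta alpha * rho2 <= x <= rho2 -> M2 * rho2 <= f x) ->
  exists u1 u2 : R -> R,
    positive_solution T eta alpha a f u1 /\
    positive_solution T eta alpha a f u2 /\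
    0 < supnorm T u1 /\ supnorm T u1 < rho2 /\ rho2 < supnorm T u2.
Proof.
  intros HT Heta Halpha Hfc Hf0 Hac Ha0 Ht0 Hat0 Hlim0 Hlimoo Hrho HM Hbig.
  assert (Hae : alpha * eta < 1).
  { rewrite <- (Rinv_l eta) by lra. apply Rmult_lt_compat_r; lra. }
  set (A := fun t => a (clamp T t)).
  assert (HA : forall x, continuous A x)
    by (apply (continuous_clamp_comp (fun t => 0 <= t <= T)); [lra|auto|exact Hac]).
  destruct (clamp_comp_bounded T a ltac:(lra) HA) as [Ka HKa].
  assert (HAb : forall t, 0 <= A t <= Ka)
    by (intros t; split; [apply Ha0, clamp_bounds; lra|apply HKa]).
  (* The smallness required by [defect_ge0_of_small_source]; [Ka + 1] avoids division by zero. *)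
  set (e := (1 - alpha * eta) / (T * T * (Ka + 1))).
  assert (HKa1 : 0 < Ka + 1) by (specialize (HAb 0); lra).
  assert (HTT : 0 < T * T * (Ka + 1)) by (repeat apply Rmult_lt_0_compat; lra).
  assert (He : 0 < e) by (apply Rdiv_lt_0_compat; lra).
  assert (HeK : T * T * (Ka * e) <= 1 - alpha * eta).
  { replace (1 - alpha * eta) with (T * T * ((Ka + 1) * e)) by (unfold e; field; lra).
    apply Rmult_le_compat_l; [apply Rmult_le_pos; lra|]. apply Rmult_le_compat_r; lra. }
  destruct (sublinear_at_0 f e rho2 Hfc Hlim0 He Hrho) as [p [Hp Hfp]].
  destruct (sublinear_at_infty f e rho2 Hfc Hlimoo He Hrho) as [q [Hq Hfq]].
  (* All initial values used lie in [(0, q]], and solutions stay below their initial value. *)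
  set (g := fun x => f (clamp q x)).
  assert (Hg : forall x, continuous g x)
    by (apply (continuous_clamp_comp (fun x => 0 <= x)); [lra|intros; lra|exact Hfc]).
  destruct (clamp_comp_bounded q f ltac:(lra) Hg) as [Kg HKg].
  assert (Hgb : forall x, 0 <= g x <= Kg)
    by (intros x; split; [apply Hf0, clamp_bounds; lra|apply HKg]).
  pose proof (clamp_comp_uniformly_continuous q f ltac:(lra) Hg) as Hgu.
  assert (HAa : forall t, 0 <= t <= T -> A t = a t) by (intros; unfold A; now rewrite clamp_id).
  assert (HD : 0 < kernel_integral T eta alpha A).
  { apply (kernel_integral_pos T eta alpha t0); auto; try lra.
    - intros x _. apply HAb.
    - now rewrite HAa. }
  assert (HMA : Lambda2 T eta alpha A <= M2).
  { change (Lambda2 T eta alpha A)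
      with ((1 - alpha * eta) / (gamma_c T eta alpha * kernel_integral T eta alpha A)).
    now rewrite (kernel_integral_ext T eta alpha A a Heta HAa). }
  pose proof (gamma_pos T eta alpha Heta (proj1 Halpha) Hae) as Hgamma.
  assert (Hpos : forall c, 0 <= c <= q -> (forall x, 0 <= x <= c -> f x <= e * c) ->
    forall h w, 0 <= h -> (forall x, continuous w x) -> (forall t, w t = delay_map T A g h c w t) ->
      0 <= defect T eta alpha w).
  { intros c Hc Hfce h w _ Hwc Hw.
    apply (defect_ge0_of_small_source T Ka Kg A g HT HA HAb Hgb Hgu eta alpha Heta (proj1 Halpha)
      h c w Hwc Hw e); [lra| |exact HeK].
    intros x Hx. apply Hfce. split; [apply clamp_bounds; lra|].
    unfold clamp. apply Rmax_lub; [lra|]. apply Rle_trans with (2 := Hx), Rmin_l. }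
  assert (Hneg : forall h w, 0 <= h -> (forall x, continuous w x) ->
    (forall t, w t = delay_map T A g h rho2 w t) -> defect T eta alpha w < 0).
  { intros h w _ Hwc Hw.
    apply (defect_lt0_of_large_source T Ka Kg A g HT HA HAb Hgb Hgu eta alpha Heta (proj1 Halpha)
      Hae h rho2 w Hwc Hw M2 HD Hrho HMA).
    intros x Hx. unfold g. rewrite clamp_id; [now apply Hbig|].
    assert (0 < gamma_c T eta alpha * rho2) by now apply Rmult_lt_0_compat. lra. }
  assert (Hsol : forall c, 0 < c <= q -> (forall x, 0 <= x <= c -> f x <= e * c) ->
    exists d u, Rmin c rho2 <= d <= Rmax c rho2 /\ d <> rho2 /\
      positive_solution T eta alpha a f u /\ supnorm T u = d).
  { intros c Hc Hfce.
    destruct (shooting_solution T Ka Kg A g HT HA HAb Hgb Hgu eta alpha ltac:(lra) ltac:(lra) c rho2)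
      as [d [w [Hd [Hwc [Hw Hdef]]]]].
    - apply Hpos; [lra|exact Hfce].
    - intros h w Hh Hwc Hw. apply Rlt_le. now apply (Hneg h w).
    - assert (Hdq : 0 < d <= q).
      { revert Hd. unfold Rmin, Rmax. repeat destruct Rle_dec; lra. }
      destruct (positive_solution_of_delay_map T eta alpha q d Ka Kg a f w) as [u Hu]; auto; try lra.
      exists d, u. split; [exact Hd|]. split; [|exact Hu].
      (* The shooting interval is closed; strict negativity at delay 0 removes its endpoint
         [rho2]. *)
      intros ->. specialize (Hneg 0 w (Rle_refl 0) Hwc Hw). lra. }
  destruct (Hsol p ltac:(lra) Hfp) as [d1 [u1 [Hd1 [Hn1 [Hu1 Hs1]]]]].
  destruct (Hsol q ltac:(lra) Hfq) as [d2 [u2 [Hd2 [Hn2 [Hu2 Hs2]]]]].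
  rewrite Rmin_left, Rmax_right in Hd1 by lra. rewrite Rmin_right, Rmax_left in Hd2 by lra.
  exists u1, u2. rewrite Hs1, Hs2. repeat split; try apply Hu1; try apply Hu2; lra.
Qed.
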